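(* For each $A\in\{\mathrm{A\text{-}Hub},\mathrm{A\text{-}Sub},\mathrm{A\text{-}TV}\}$, there exist instances for which the adaptive sample complexity undergoes a polynomial jump when the contamination parameter is scaled by a factor arbitrarily close to $1$. That is: for every $\lambda>1$ there exist constants $a>1$, $c>0$ and a sequence of triples $(p_k,q_k,\eta_k)$, with $p_k,q_k$ probability distributions on a finite set and $\eta_k>0$, $\lambda\eta_k<1$, such that, writing $n^*_{A,k}(\cdot)$ for the sample complexity under model $A$ for testing $p_k$ versus $q_k$, one has $n^*_{A,k}(\eta_k)\to\infty$, $n^*_{A,k}(\lambda\eta_k)<\infty$ for all $k$, and $$n^*_{A,k}(\lambda\eta_k)\ \ge\ c\,\big(n^*_{A,k}(\eta_k)\big)^{a}\quad\text{for all }k.$$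
   Context: Adaptive models at level $\varepsilon$ with $n$ samples, for distributions $p,q$ on a finite set $\mathcal X$: an adversary sees the whole clean dataset and then corrupts it. A-TV: clean dataset $X_1,\dots,X_n$ i.i.d.; the adversary chooses $\lfloor n\varepsilon\rfloor$ samples and replaces them by arbitrary values in $\mathcal X$, and the result is released after a uniformly random permutation. A-Hub: clean dataset $X_1,\dots,X_{n-\lfloor n\varepsilon\rfloor}$ i.i.d.; the adversary adds $\lfloor n\varepsilon\rfloor$ samples of its choosing, and the $n$-sample dataset is released after a uniformly random permutation. A-Sub: clean dataset $X_1,\dots,X_n$ i.i.d.; the adversary replaces $\lfloor n\varepsilon\rfloor$ samples of its choosing by a symbol $\perp$ and releases the result. The sample complexity $n^*_A(\varepsilon)$ is the smallest $n$ for which there is a (possibly randomised) test on the released dataset whose worst case type-I error (supremum over adversaries of the probability of output $1$ when clean samples are from $p$) plus worst case type-II error (supremum over adversaries of the probability of output $0$ when clean samples are from $q$) is at most $\frac1{10}$ ($\infty$ if no such $n$ exists). *)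

(* Defs.v *)
From HB Require Import structures.
From mathcomp Require Import all_boot all_order all_algebra all_fingroup.
From mathcomp Require Import all_classical all_reals all_analysis.

Set Implicit Arguments.
Unset Strict Implicit.
Unset Printing Implicit Defensive.

Import Order.TTheory GRing.Theory Num.Theory.

Local Open Scope classical_set_scope.
Local Open Scope ring_scope.

Definition is_pmf (R : realType) (T : finType) (p : T -> R) : Prop :=
  (forall x, 0 <= p x) /\ \sum_x p x = 1.

Definition iid (R : realType) (T : finType) (p : T -> R) (N : nat)
    (x : N.-tuple T) : R :=
  \prod_(i < N) p (tnth x i).

(* A contamination protocol releasing n samples: [corruptions x] is the set of
   datasets the adversary may produce from the clean dataset x, before the
   random permutation (performed only when [shuffled] holds). *)
Record protocol (T : finType) (n : nat) := Protocol {
  alphabet : finType;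
  clean_size : nat;
  corruptions : clean_size.-tuple T -> {set n.-tuple alphabet};
  shuffled : bool }.

(* In the three protocols m is the number of corrupted samples. *)

(* Replaced samples may keep their value, as the new values are arbitrary. *)
Definition TV_protocol (T : finType) (n m : nat) : protocol T n :=
  @Protocol T n T n
    (fun x => [set z : n.-tuple T | [exists S : {set 'I_n},
       (#|S| == m) && [forall i, (i \notin S) ==> (tnth z i == tnth x i)]]])%SET
    true.

Definition Hub_protocol (T : finType) (n m : nat) : protocol T n :=
  @Protocol T n T (n - m)%N
    (fun x => [set z : n.-tuple T | [exists y : m.-tuple T,
       tval z == tval x ++ tval y]])%SET
    true.

(* [None] is the erasure symbol. *)
Definition Sub_protocol (T : finType) (n m : nat) : protocol T n :=
  @Protocol T n (option T) n
    (fun x => [set z : n.-tuple (option T) | [exists S : {set 'I_n},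
       (#|S| == m) &&
       (z == [tuple if i \in S then None else Some (tnth x i) | i < n])]])%SET
    false.

Inductive adaptive_model := A_Hub | A_Sub | A_TV.

Definition adaptive_protocol (R : realType) (A : adaptive_model) (T : finType)
    (n : nat) (eps : R) : protocol T n :=
  let m := Num.truncn (n%:R * eps) in
  match A with
  | A_Hub => Hub_protocol T n m
  | A_Sub => Sub_protocol T n m
  | A_TV => TV_protocol T n m
  end.

Section Testing.
Variables (R : realType) (T : finType) (n : nat) (P : protocol T n).

(* An adversary may randomise: seeing the clean dataset x, it outputs z with
   probability K x z. Deterministic adversaries are the Dirac kernels. *)
Definition is_adversary
    (K : (clean_size P).-tuple T -> n.-tuple (alphabet P) -> R) : Prop :=
  forall x, is_pmf (K x) /\ (forall z, K x z != 0 -> z \in corruptions x).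

(* Expectation of f over the released dataset, given the corrupted one. *)
Definition release (f : n.-tuple (alphabet P) -> R)
    (z : n.-tuple (alphabet P)) : R :=
  if shuffled P
  then (n`!%:R)^-1 * \sum_(s : 'S_n) f [tuple tnth z (s i) | i < n]
  else f z.

Definition released_mean (p : T -> R)
    (K : (clean_size P).-tuple T -> n.-tuple (alphabet P) -> R)
    (f : n.-tuple (alphabet P) -> R) : R :=
  \sum_x iid p x * \sum_z K x z * release f z.

(* A randomised test is given by its probability of answering 1. *)
Definition is_test (phi : n.-tuple (alphabet P) -> R) : Prop :=
  forall z, 0 <= phi z <= 1.

Definition type_I_error (p : T -> R) (phi : n.-tuple (alphabet P) -> R) : R :=
  sup [set released_mean p K phi | K in is_adversary].

Definition type_II_error (q : T -> R) (phi : n.-tuple (alphabet P) -> R) : R :=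
  sup [set released_mean q K (fun z => 1 - phi z) | K in is_adversary].

Definition testable (p q : T -> R) : Prop :=
  exists phi : n.-tuple (alphabet P) -> R,
    is_test phi /\ type_I_error p phi + type_II_error q phi <= 10%:R^-1.

End Testing.

(* The least such n (an infimum of naturals is attained), +oo if there is
   none. The errors are meaningful for 0 <= eps <= 1: beyond that there may be
   no adversary, and sup set0 = 0. *)
Definition sample_complexity (R : realType) (A : adaptive_model) (T : finType)
    (p q : T -> R) (eps : R) : \bar R :=
  ereal_inf [set n%:R%:E | n in
    [set n : nat | testable (adaptive_protocol A T n eps) p q]].

(* Main.v *)
(* The pair (p, q) carries evidence at two scales. A rare letter, of mass
   t = sqrt(eta), has its mass shifted by d, where d lies strictly between the
   largest shifts which corruptions of level eta and of level lambda * eta can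
   hide; a frequent letter has its mass shifted by D = O(eta), a large multiple
   of lambda * eta.
   At level eta, counting the rare letter succeeds with O(t / d^2) = O(t^-3)
   samples. At level lambda * eta, the adversaries couple the two clean datasets
   so that they differ in about n d places and make them indistinguishable,
   except for the shift of the frequent letter, which cannot be seen with fewer
   than c / D^2 = c t^-4 samples. The budget exceeds n d with high probability
   only once n eta is large; since d is much smaller than t, the smaller values
   of n are ruled out already without corruption, by the chi-square divergence
   d^2 / t of a single sample. Hence the exponent a = 4/3. *)
Require Import Defs.
From mathcomp Require Import all_boot all_order all_algebra.
From mathcomp Require Import all_classical all_reals all_analysis.
From mathcomp Require Import all_fingroup ring lra zify.
Import Order.TTheory GRing.Theory Num.Theory.
Import numFieldNormedType.Exports.
Local Open Scope classical_set_scope.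
Local Open Scope ring_scope.

Set Implicit Arguments.
Unset Strict Implicit.
Unset Printing Implicit Defensive.

(** * Independent samples *)

Lemma sum_prod_tuple (R : realType) (T : finType) (N : nat) (F : 'I_N -> T -> R) :
  \sum_(x : N.-tuple T) \prod_(i < N) F i (tnth x i) =
  \prod_(i < N) \sum_t F i t.
Proof.
rewrite bigA_distr_bigA /=.
rewrite (reindex (fun f : {ffun 'I_N -> T} => [tuple f i | i < N])) /=.
  by apply: eq_bigr => f _; apply: eq_bigr => i _; rewrite tnth_mktuple.
exists (fun x : N.-tuple T => [ffun i => tnth x i]) => [f _|x _].
  by apply/ffunP => i; rewrite ffunE tnth_mktuple.
by apply: eq_from_tnth => i; rewrite tnth_mktuple ffunE.
Qed.

Lemma iid_ge0 (R : realType) (T : finType) (p : T -> R) (N : nat)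
    (x : N.-tuple T) : is_pmf p -> 0 <= iid p x.
Proof. by case=> p0 _; apply: prodr_ge0. Qed.

Lemma iid_pmf (R : realType) (T : finType) (p : T -> R) (N : nat) :
  is_pmf p -> is_pmf (@iid R T p N).
Proof.
move=> pP; split=> [x|]; first exact: iid_ge0.
rewrite (sum_prod_tuple (fun _ => p)).
by case: pP => _ ->; rewrite big1_eq.
Qed.

(** Distributivity expands the product of fibre sums over all tuples of [U]; a tuple off the fibre
    has a coordinate whose factor vanishes. This transfers a one-letter coupling to whole
    datasets. *)
Lemma iid_pushforward (R : realType) (U T : finType) (mu : U -> R) (f : U -> T)
    (p : T -> R) (N : nat) (x : N.-tuple T) :
  (forall t, p t = \sum_(u | f u == t) mu u) ->
  iid p x = \sum_(u : N.-tuple U | map_tuple f u == x) iid mu u.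
Proof.
move=> pE; rewrite /iid [RHS]big_mkcond /=.
transitivity (\prod_(i < N) \sum_u (if f u == tnth x i then mu u else 0)).
  by apply: eq_bigr => i _; rewrite pE big_mkcond.
rewrite -(sum_prod_tuple (fun i u => if f u == tnth x i then mu u else 0)).
apply: eq_bigr => u _; case: eqP => [<-|neq].
  by apply: eq_bigr => i _; rewrite tnth_map eqxx.
have [i ne_i] : exists i, f (tnth u i) != tnth x i.
  apply/existsP; apply: contra_notT neq; rewrite negb_exists => /forallP eqi.
  by apply: eq_from_tnth => i; rewrite tnth_map; have := eqi i; rewrite negbK => /eqP.
by rewrite (bigD1 i) //= (negbTE ne_i) mul0r.
Qed.

Lemma iid_second_moment (R : realType) (T : finType) (p g : T -> R) (N : nat) :
  is_pmf p -> \sum_t p t * g t = 0 ->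
  \sum_(x : N.-tuple T) iid p x * (\sum_(i < N) g (tnth x i)) ^+ 2 =
  N%:R * \sum_t p t * g t ^+ 2.
Proof.
move=> [_ p1] g0.
(* [w i j k] is the [k]-th factor of the summand for the pair [(i, j)] of the expanded square. For
   [i != j] the factor at [i] sums to zero, as [g] is centred. *)
pose w (i j k : 'I_N) t := p t * (if k == i then g t else 1) * (if k == j then g t else 1).
transitivity (\sum_(i < N) \sum_(j < N) \prod_(k < N) \sum_t w i j k t).
  under [RHS]eq_bigr do under eq_bigr do rewrite -sum_prod_tuple.
  under [RHS]eq_bigr do rewrite exchange_big /=.
  rewrite [RHS]exchange_big /=; apply: eq_bigr => x _.
  rewrite expr2 mulr_suml mulr_sumr; apply: eq_bigr => i _.
  rewrite mulr_sumr mulr_sumr; apply: eq_bigr => j _.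
  rewrite /w !big_split /= -!big_mkcond /= !big_pred1_eq.
  by rewrite /iid mulrA.
transitivity (\sum_(i < N) \sum_t p t * g t ^+ 2); last first.
  by rewrite sumr_const card_ord mulr_natl.
apply: eq_bigr => i _; rewrite (bigD1 i) //= [X in _ + X]big1 ?addr0 => [|j ji].
  rewrite (bigD1 i) //= [X in _ * X]big1 ?mulr1 => [|k ki].
    by apply: eq_bigr => t _; rewrite /w eqxx expr2 mulrA.
  by rewrite -[RHS]p1; apply: eq_bigr => t _; rewrite /w (negbTE ki) !mulr1.
rewrite (bigD1 i) //= [X in X * _](_ : _ = 0) ?mul0r //.
rewrite -[RHS]g0; apply: eq_bigr => t _.
by rewrite /w eqxx eq_sym (negbTE ji) mulr1.
Qed.

(** The one-letter variance is bounded by the mass of [a] itself, so a rare event gets a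
    correspondingly small bound. *)
Lemma iid_chebyshev (R : realType) (T : finType) (p : T -> R) (a : pred T)
    (N : nat) (s : R) : is_pmf p -> 0 < s ->
  \sum_(x : N.-tuple T | s <= `|(count a x)%:R - N%:R * \sum_(t | a t) p t|)
     iid p x <= N%:R * (\sum_(t | a t) p t) / s ^+ 2.
Proof.
move=> pP s0; have [p0 p1] := pP.
set pa := \sum_(t | a t) p t.
pose g t : R := (a t)%:R - pa.
have pge0 : 0 <= pa by apply: sumr_ge0.
have paE : \sum_t p t * (a t)%:R = pa.
  rewrite [RHS]big_mkcond; apply: eq_bigr => t _.
  by case: (a t); rewrite ?mulr1 ?mulr0.
have g0 : \sum_t p t * g t = 0.
  under eq_bigr do rewrite mulrBr.
  by rewrite big_split /= paE sumrN -mulr_suml p1 mul1r subrr.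
have g2 : \sum_t p t * g t ^+ 2 <= pa.
  have -> : \sum_t p t * g t ^+ 2 = pa - pa ^+ 2.
    transitivity (\sum_t (p t * (a t)%:R * (1 - 2 * pa) + p t * pa ^+ 2)).
      by apply: eq_bigr => t _; rewrite /g; case: (a t) => /=; ring.
    by rewrite big_split /= -!mulr_suml paE p1; ring.
  by rewrite gerBl sqr_ge0.
have cE (x : N.-tuple T) : (count a x)%:R - N%:R * pa = \sum_(i < N) g (tnth x i).
  rewrite /g sumrB sumr_const card_ord mulr_natl; congr (_ - _).
  by rewrite -sum1_count natr_sum big_tuple big_mkcond /=; apply: eq_bigr => i _; case: (a _).
rewrite ler_pdivlMr ?exprn_gt0 // mulr_suml.
apply: (@le_trans _ _ (N%:R * \sum_t p t * g t ^+ 2)); last first.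
  by rewrite ler_wpM2l.
rewrite -(iid_second_moment _ pP g0) big_mkcond; apply: ler_sum => x _.
case: ifP => [ler|_]; last by rewrite mulr_ge0 ?sqr_ge0 ?iid_ge0.
rewrite ler_wpM2l ?iid_ge0 // -cE -[leRHS]real_normK ?num_real //.
by rewrite lerXn2r // nnegrE ltW.
Qed.

(* The chi-square divergence tensorises exactly: 1 + chi2 is multiplicative. *)
Lemma iid_chi2 (R : realType) (T : finType) (p q : T -> R) (N : nat) :
  is_pmf p -> is_pmf q -> (forall t, 0 < p t) ->
  N%:R * \sum_t (q t - p t) ^+ 2 / p t <= 101^-1 ->
  \sum_(x : N.-tuple T) `|iid q x - iid p x| <= 10^-1.
Proof.
move=> pP qP p0; set chi := \sum_t _ => Nchi.
have [_ p1] := pP; have [_ q1] := qP.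
have chi0 : 0 <= chi by apply: sumr_ge0 => t _; rewrite mulr_ge0 ?sqr_ge0 ?invr_ge0 ?ltW.
have i0 (x : N.-tuple T) : 0 < iid p x by apply: prodr_gt0.
have [_ ip1] := iid_pmf N pP; have [_ iq1] := iid_pmf N qP.
have chiN : \sum_(x : N.-tuple T) (iid q x - iid p x) ^+ 2 / iid p x = (1 + chi) ^+ N - 1.
  transitivity (\sum_(x : N.-tuple T) (\prod_(i < N) (q (tnth x i) ^+ 2 / p (tnth x i))
                 - 2 * iid q x + iid p x)).
    apply: eq_bigr => x _; rewrite big_split /= prodfV prodrXl -/(iid q x) -/(iid p x).
    by field; rewrite gt_eqF.
  rewrite big_split sumrB /= -mulr_sumr ip1 iq1.
  rewrite (sum_prod_tuple (fun _ t => q t ^+ 2 / p t)) prodr_const card_ord.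
  have -> : \sum_t q t ^+ 2 / p t = 1 + chi.
    transitivity (\sum_t ((q t - p t) ^+ 2 / p t + 2 * q t - p t)).
      by apply: eq_bigr => t _; field; rewrite gt_eqF.
    by rewrite sumrB big_split /= -mulr_sumr p1 q1 -/chi; ring.
  by ring.
have bern (y : R) : 0 <= y <= 1 -> 1 - N%:R * y <= (1 - y) ^+ N.
  move=> /andP[y0 y1]; elim: N {Nchi i0 ip1 iq1 chiN} => [|M IH]; first by rewrite expr0 mul0r subr0.
  have M0 : 0 <= M%:R :> R by [].
  have y1' : 0 <= 1 - y by lra.
  by rewrite exprS -natr1; apply: le_trans (ler_wpM2l y1' IH); nra.
(* As [(1 + chi) ^+ N * (1 - chi) ^+ N <= 1], Bernoulli's inequality bounds the first factor by the
   inverse of [1 - N * chi], hence by 101/100. *)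
have chiN_le : (1 + chi) ^+ N - 1 <= 100^-1.
  case: (posnP N) => [N0|Npos]; first by rewrite [in X in _ ^+ X]N0 expr0; lra.
  have N1 : 1 <= N%:R :> R by rewrite ler1n.
  have chi1 : chi <= 101^-1 by nra.
  have h1 := bern chi; have {}h1 : 1 - N%:R * chi <= (1 - chi) ^+ N by apply: h1; lra.
  have h2 : (1 + chi) ^+ N * (1 - chi) ^+ N <= 1.
    by rewrite -exprMn exprn_ile1 //; nra.
  have h3 : 0 <= (1 + chi) ^+ N by apply: exprn_ge0; lra.
  by nra.
(* The weights 1/20 and 5 balance the two contributions: 1/20 + 5/100 = 1/10. *)
apply: (@le_trans _ _ (\sum_(x : N.-tuple T)
   (iid p x / 20 + 5 * ((iid q x - iid p x) ^+ 2 / iid p x)))).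
  apply: ler_sum => x _; have := i0 x.
  set P := iid p x; set Q := iid q x => P0.
  (* AM-GM *)
  have -> : P / 20 + 5 * ((Q - P) ^+ 2 / P) =
            `|Q - P| + (P - 10 * `|Q - P|) ^+ 2 / (20 * P).
    have -> : (Q - P) ^+ 2 = `|Q - P| ^+ 2 by rewrite real_normK ?num_real.
    by field; rewrite gt_eqF.
  by rewrite lerDl divr_ge0 ?sqr_ge0 // mulr_ge0 // ltW.
by rewrite big_split /= -mulr_suml -mulr_sumr chiN ip1; lra.
Qed.

(** * Adversaries and errors *)

Lemma releaseB (R : realType) (T : finType) (n : nat) (P : protocol T n)
    (f : n.-tuple (alphabet P) -> R) z :
  release (fun z => 1 - f z) z = 1 - release f z.
Proof.
rewrite /release; case: ifP => // _.
rewrite sumrB sumr_const card_Sn mulrBr mulVf //.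
Qed.

Lemma release_ge0 (R : realType) (T : finType) (n : nat) (P : protocol T n)
    (f : n.-tuple (alphabet P) -> R) z : is_test f -> 0 <= release f z.
Proof.
move=> f01; have f0 y : 0 <= f y by case/andP: (f01 y).
rewrite /release; case: ifP => // _.
by rewrite mulr_ge0 ?invr_ge0 // sumr_ge0.
Qed.

Lemma release_le1 (R : realType) (T : finType) (n : nat) (P : protocol T n)
    (f : n.-tuple (alphabet P) -> R) z : is_test f -> release f z <= 1.
Proof.
move=> f01; rewrite -subr_ge0 -releaseB; apply: release_ge0 => y.
by have /andP[] := f01 y; rewrite subr_ge0 lerBlDr lerDl => -> ->.
Qed.

Lemma mean_pmf_itv (R : realType) (U : finType) (mu f : U -> R) :
  is_pmf mu -> (forall u, 0 <= f u <= 1) -> 0 <= \sum_u mu u * f u <= 1.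
Proof.
move=> [mu0 mu1] f01; apply/andP; split.
  by apply: sumr_ge0 => u _; have /andP[f0 _] := f01 u; rewrite mulr_ge0.
rewrite -mu1; apply: ler_sum => u _; have /andP[_ f1] := f01 u.
by rewrite ler_piMr.
Qed.

Lemma released_mean_itv (R : realType) (T : finType) (n : nat)
    (P : protocol T n) (p : T -> R)
    (K : (clean_size P).-tuple T -> n.-tuple (alphabet P) -> R) f :
  is_pmf p -> is_adversary K -> is_test f -> 0 <= released_mean p K f <= 1.
Proof.
move=> pP KP fP; apply: mean_pmf_itv => [|x]; first exact: iid_pmf.
apply: mean_pmf_itv => [|z]; first by case: (KP x).
by rewrite release_ge0 ?release_le1.
Qed.

Lemma released_meanB (R : realType) (T : finType) (n : nat)
    (P : protocol T n) (p : T -> R)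
    (K : (clean_size P).-tuple T -> n.-tuple (alphabet P) -> R) f :
  is_pmf p -> is_adversary K ->
  released_mean p K (fun z => 1 - f z) = 1 - released_mean p K f.
Proof.
move=> pP KP; have [_ i1] := iid_pmf (clean_size P) pP.
rewrite -[X in X - _]i1 -sumrB; apply: eq_bigr => x _.
have [[_ k1] _] := KP x; rewrite -[X in X - _]mulr1 -mulrBr; congr (_ * _).
rewrite -[X in X - _]k1 -sumrB; apply: eq_bigr => z _.
by rewrite releaseB mulrBr mulr1.
Qed.

Lemma is_testB (R : realType) (T : finType) (n : nat) (P : protocol T n)
    (f : n.-tuple (alphabet P) -> R) :
  is_test f -> is_test (fun z => 1 - f z).
Proof. by move=> fP z; have := fP z; lra. Qed.

Lemma released_mean_le_type_I (R : realType) (T : finType) (n : nat)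
    (P : protocol T n) (p : T -> R)
    (K : (clean_size P).-tuple T -> n.-tuple (alphabet P) -> R) f :
  is_pmf p -> is_adversary K -> is_test f ->
  released_mean p K f <= type_I_error p f.
Proof.
move=> pP KP fP; apply: ub_le_sup; last by exists K.
by exists 1 => _ [L LP <-]; case/andP: (released_mean_itv pP LP fP).
Qed.

Lemma type_I_error_le (R : realType) (T : finType) (n : nat)
    (P : protocol T n) (p : T -> R) (f : n.-tuple (alphabet P) -> R) (b : R) :
  0 <= b -> (forall K, is_adversary K -> released_mean p K f <= b) ->
  type_I_error p f <= b.
Proof.
move=> b0 rb; rewrite /type_I_error; set S := (X in sup X).
(* Without adversaries the error is [sup set0], that is 0; this case uses [0 <= b]. *)
have [->|/set0P S0] := eqVneq S set0; first by rewrite sup0.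
by apply: ge_sup => // _ [K KP <-]; exact: rb.
Qed.

Lemma type_II_errorE (R : realType) (T : finType) (n : nat)
    (P : protocol T n) (q : T -> R) (f : n.-tuple (alphabet P) -> R) :
  type_II_error q f = type_I_error q (fun z => 1 - f z).
Proof. by []. Qed.

Lemma type_I_error_ge0 (R : realType) (T : finType) (n : nat)
    (P : protocol T n) (p : T -> R) (f : n.-tuple (alphabet P) -> R) :
  is_pmf p -> is_test f -> 0 <= type_I_error p f.
Proof.
move=> pP fP; rewrite /type_I_error; set S := (X in sup X).
have [->|/set0P[_ [K KP _]]] := eqVneq S set0; first by rewrite sup0.
have /andP[r0 _] := released_mean_itv pP KP fP.
exact: le_trans r0 (released_mean_le_type_I pP KP fP).
Qed.

(** The same adversary is played against both laws; given the clean dataset, its mean outcome lies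
    in the unit interval, so only the distance between the clean laws is paid. *)
Lemma type_I_error_lipschitz (R : realType) (T : finType) (n : nat)
    (P : protocol T n) (p q : T -> R) (f : n.-tuple (alphabet P) -> R) :
  is_pmf q -> is_test f ->
  type_I_error p f <= type_I_error q f +
    \sum_(x : (clean_size P).-tuple T) `|iid p x - iid q x|.
Proof.
move=> qP fP; apply: type_I_error_le => [|K KP].
  by rewrite addr_ge0 ?type_I_error_ge0 // sumr_ge0.
apply: le_trans (lerD (released_mean_le_type_I qP KP fP) (lexx _)).
rewrite -lerBlDl -sumrB; apply: ler_sum => x _; rewrite -mulrBl.
have [Kx _] := KP x.
have /andP[m0 m1] : 0 <= \sum_z K x z * release f z <= 1.
  by apply: mean_pmf_itv => // z; rewrite release_ge0 ?release_le1.
apply: le_trans (ler_norm _) _; rewrite normrM ler_piMr //.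
by rewrite ger0_norm.
Qed.

(* An adversary who sees x may resample hidden randomness u with f(u) = x from
   its conditional law, and then act as a function zeta of u. *)
Lemma latent_adversary (R : realType) (T : finType) (n : nat)
    (P : protocol T n) (U : finType) (mu : U -> R) (f : U -> T) (p : T -> R)
    (zeta : (clean_size P).-tuple U -> n.-tuple (alphabet P)) :
  is_pmf mu -> (forall t, p t = \sum_(u | f u == t) mu u) ->
  (forall x : (clean_size P).-tuple T, exists z, z \in corruptions x) ->
  (forall u, zeta u \in corruptions (map_tuple f u)) ->
  exists K, is_adversary K /\ forall g,
    released_mean p K g = \sum_u iid mu u * release g (zeta u).
Proof.
move=> muP pE cx zc.
have pushE (x : (clean_size P).-tuple T) := iid_pushforward x pE.
(* On datasets of probability zero the conditional law is undefined; a fixed legal corruption keeps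
   [K x] a probability distribution. *)
pose K x z : R := if iid p x == 0 then (z == xchoose (cx x))%:R
  else (iid p x)^-1 * \sum_(u | map_tuple f u == x) iid mu u * (zeta u == z)%:R.
have sum1 (A : finType) (a : A) : \sum_b (a == b)%:R = 1 :> R.
  by rewrite (bigD1 a) //= eqxx big1 ?addr0 // => b /negbTE; rewrite eq_sym => ->.
exists K; split=> [x|g].
  rewrite /K; case: eqP => [_|/eqP px0]; split; first split.
  - by [].
  - by under eq_bigr do rewrite eq_sym; exact: sum1.
  - by move=> z; have [->|] := eqVneq z (xchoose (cx x)); [move=> _; exact: (xchooseP (cx x)) | rewrite eqxx].
  - split=> [z|].
      rewrite mulr_ge0 ?invr_ge0 ?pushE ?sumr_ge0 // => u _;
        by rewrite ?mulr_ge0 ?iid_ge0.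
    rewrite -mulr_sumr exchange_big /=.
    under eq_bigr do rewrite -mulr_sumr sum1 mulr1.
    by rewrite -pushE mulVf.
  - move=> z; apply: contra_neqT => zx; rewrite big1 ?mulr0 // => u /eqP ux.
    by case: eqP zx => [<-|]; rewrite ?mulr0 // -ux zc.
rewrite (partition_big (map_tuple f) xpredT) //=; apply: eq_bigr => x _.
rewrite /K; case: eqP => [px0|/eqP px0].
  rewrite px0 mul0r big1 // => u /eqP ux; apply/eqP; rewrite mulf_eq0; apply/orP; left.
  have /eqP := pushE x; rewrite px0 eq_sym psumr_eq0 => [|v _]; last exact: iid_ge0.
  by move=> /allP /(_ u (mem_index_enum _)); rewrite ux eqxx.
rewrite [in LHS](eq_bigr (fun z => (iid p x)^-1 *
  \sum_(u | map_tuple f u == x) iid mu u * ((zeta u == z)%:R * release g z))); last first.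
  by move=> z _; rewrite -mulrA mulr_suml; congr (_ * _); apply: eq_bigr => u _; rewrite mulrA.
rewrite -mulr_sumr mulrA divff // mul1r exchange_big /=; apply: eq_bigr => u _.
rewrite -mulr_sumr; congr (_ * _).
rewrite (bigD1 (zeta u)) //= eqxx mul1r big1 ?addr0 // => z /negbTE.
by rewrite eq_sym => ->; rewrite mul0r.
Qed.

(** Le Cam's argument: both adversaries draw on the same coupled pairs, and on [good] draws the test
    behaves identically under both hypotheses, where its two error probabilities add up to 1. *)
Lemma coupling_error_sum (R : realType) (T : finType) (n : nat)
    (P : protocol T n) (mu : T * T -> R) (p q : T -> R)
    (good : pred ((clean_size P).-tuple (T * T))) (phi : n.-tuple (alphabet P) -> R) :
  is_pmf mu -> is_pmf p -> is_pmf q ->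
  (forall t, p t = \sum_(u | u.1 == t) mu u) ->
  (forall t, q t = \sum_(u | u.2 == t) mu u) ->
  (forall x : (clean_size P).-tuple T, exists z, z \in corruptions x) ->
  (forall u, exists z1 z2, [/\ z1 \in corruptions (map_tuple fst u),
      z2 \in corruptions (map_tuple snd u) &
      good u -> forall g : n.-tuple (alphabet P) -> R, release g z1 = release g z2]) ->
  is_test phi ->
  1 - \sum_(u | ~~ good u) iid mu u <= type_I_error p phi + type_II_error q phi.
Proof.
move=> muP pP qP pE qE cx meet phiP.
pose z1 u := projT1 (cid (meet u)).
pose z2 u := projT1 (cid (projT2 (cid (meet u)))).
have zP u : [/\ z1 u \in corruptions (map_tuple fst u),
    z2 u \in corruptions (map_tuple snd u) &
    good u -> forall g : n.-tuple (alphabet P) -> R, release g (z1 u) = release g (z2 u)].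
  exact: projT2 (cid (projT2 (cid (meet u)))).
have [K1 [K1P K1E]] : exists K, is_adversary K /\ forall g,
    released_mean p K g = \sum_u iid mu u * release g (z1 u).
  by apply: latent_adversary pE cx _ => // u; case: (zP u).
have [K2 [K2P K2E]] : exists K, is_adversary K /\ forall g,
    released_mean q K g = \sum_u iid mu u * release g (z2 u).
  by apply: latent_adversary qE cx _ => // u; case: (zP u).
apply: le_trans (lerD (released_mean_le_type_I pP K1P phiP)
  (released_mean_le_type_I qP K2P (is_testB phiP))).
rewrite released_meanB // K1E K2E addrCA lerD2l -opprB -sumrB lerN2.
rewrite [leRHS]big_mkcond; apply: ler_sum => u _; rewrite -mulrBr.
case: ifPn => [_|]; last first.
  by rewrite negbK => gu; case: (zP u) => _ _ /(_ gu) ->; rewrite subrr mulr0.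
rewrite -[leRHS]mulr1 ler_wpM2l ?iid_ge0 // lerBlDr.
by rewrite -[leLHS]addr0 lerD ?release_ge0 ?release_le1.
Qed.

(** One adversary, used on both sides, makes the two errors complementary. It comes from
    [latent_adversary] with the dataset itself as hidden randomness. *)
Lemma clean_error_sum (R : realType) (T : finType) (n : nat)
    (P : protocol T n) (p : T -> R) (phi : n.-tuple (alphabet P) -> R) :
  is_pmf p -> (forall x : (clean_size P).-tuple T, exists z, z \in corruptions x) ->
  is_test phi -> 1 <= type_I_error p phi + type_II_error p phi.
Proof.
move=> pP cx phiP; have [K [KP _]] := @latent_adversary R T n P T p id p
  (fun u => xchoose (cx (map_tuple id u))) pP
  (fun t => esym (big_pred1_eq _ _ _)) cx (fun u => xchooseP (cx (map_tuple id u))).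
apply: le_trans (lerD (released_mean_le_type_I pP KP phiP)
  (released_mean_le_type_I pP KP (is_testB phiP))).
by rewrite released_meanB // addrC subrK.
Qed.

(** A permutation-invariant test is unaffected by the shuffle, so an error can occur only if the
    clean dataset is already bad, whatever the adversary does. *)
Lemma deterministic_test_testable (R : realType) (T : finType) (n : nat)
    (P : protocol T n) (p q : T -> R) (phi : pred (n.-tuple (alphabet P)))
    (bad1 bad2 : pred ((clean_size P).-tuple T)) :
  is_pmf p -> is_pmf q ->
  (forall z (s : 'S_n), phi [tuple tnth z (s i) | i < n] = phi z) ->
  (forall x z, z \in corruptions x -> phi z -> bad1 x) ->
  (forall x z, z \in corruptions x -> ~~ phi z -> bad2 x) ->
  \sum_(x | bad1 x) iid p x + \sum_(x | bad2 x) iid q x <= 10^-1 ->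
  testable P p q.
Proof.
move=> pP qP phi_perm b1 b2 le10; pose f z : R := (phi z)%:R; exists f.
have fP : is_test f by move=> z; rewrite /f; case: (phi z); rewrite /= ?lexx ?ler01.
have releaseE z : release f z = (phi z)%:R.
  rewrite /release; case: ifP => // _.
  under eq_bigr do rewrite /f phi_perm.
  by rewrite sumr_const card_Sn -[X in _ * X]mulr_natl mulrA mulVf ?mul1r // pnatr_eq0 -lt0n fact_gt0.
have bound (r : T -> R) (bad : pred _) (g : n.-tuple (alphabet P) -> R) : is_pmf r ->
    (forall z, release g z <= 1) ->
    (forall x z, z \in corruptions x -> ~~ bad x -> release g z = 0) ->
    type_I_error r g <= \sum_(x | bad x) iid r x.
  move=> rP g1 g0; apply: type_I_error_le => [|K KP].
    by rewrite sumr_ge0 // => x _; exact: iid_ge0.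
  rewrite [leRHS]big_mkcond; apply: ler_sum => x _; have [[K0 K1] Kx] := KP x.
  case: ifPn => bx.
    rewrite -[leRHS]mulr1 ler_wpM2l ?iid_ge0 // -K1; apply: ler_sum => z _.
    by rewrite ler_piMr.
  rewrite big1 ?mulr0 // => z _; have [->|Kz] := eqVneq (K x z) 0.
    by rewrite mul0r.
  by rewrite (g0 x) ?mulr0 // Kx.
split=> //; apply: le_trans le10; rewrite type_II_errorE lerD //; apply: bound => //.
- by move=> z; exact: release_le1.
- by move=> x z zx; apply: contraNeq; rewrite releaseE; case: (phi z) (b1 x z zx) => //= [->//|]; rewrite eqxx.
- by move=> z; apply: release_le1; exact: is_testB.
- move=> x z zx; apply: contraNeq; rewrite releaseB releaseE.
  by case: (phi z) (b2 x z zx) => /= [|->//]; rewrite subrr eqxx.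
Qed.

(** * The three contamination models *)

(** Indexed by the integer number of corruptions, which keeps the rounding of [n * eps] out of the
    combinatorics. *)
Definition model_protocol (A : adaptive_model) (T : finType) (n m : nat) :
    protocol T n :=
  match A with
  | A_Hub => Hub_protocol T n m
  | A_Sub => Sub_protocol T n m
  | A_TV => TV_protocol T n m
  end.

(* Number of disagreements between two clean datasets that m corruptions can
   hide: in A_TV each of the two adversaries handles its share of them. *)
Definition budget (A : adaptive_model) (m : nat) : nat :=
  if A is A_TV then m.*2 else m.

Lemma clean_size_bounds (A : adaptive_model) (T : finType) (n m : nat) :
  (n - m <= clean_size (model_protocol A T n m) <= n)%N.
Proof. by case: A; rewrite /= ?leqnn ?leq_subr. Qed.

Lemma count_tnth (T : eqType) (a : pred T) (N : nat) (x : N.-tuple T) :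
  count a x = (\sum_(i < N) a (tnth x i))%N.
Proof.
by rewrite -sum1_count big_tuple big_mkcond /=; apply: eq_bigr => i _; case: (a _).
Qed.

Lemma sum_agree_off (n : nat) (b c : 'I_n -> bool) (S : {set 'I_n}) :
  (forall i, i \notin S -> b i = c i) ->
  (\sum_(i < n) b i <= \sum_(i < n) c i + #|S|)%N.
Proof.
move=> bc; rewrite -sum1_card [X in (_ + X)%N]big_mkcond -big_split /=.
apply: leq_sum => i _; case: ifPn => [_|iS]; first by case: (b i); rewrite addn1.
by rewrite bc // addn0.
Qed.

(** The set consists of the first [m] entries of an enumeration listing [D] before its complement.
    It serves adversaries who must spend exactly [m] corruptions. *)
Lemma set_of_card_comparable (T : finType) (D : {set T}) (m : nat) :
  (m <= #|T|)%N -> exists S : {set T},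
    [/\ #|S| = m, (#|D| <= m)%N -> D \subset S & (m <= #|D|)%N -> S \subset D].
Proof.
move=> mT; pose s := enum D ++ enum (~: D).
have us : uniq s.
  rewrite cat_uniq !enum_uniq andbT /=; apply/hasPn => x.
  by rewrite !mem_enum inE.
have ss : size s = #|T| by rewrite size_cat -!cardE cardsC.
exists [set x in take m s]; split.
- by rewrite cardsE (card_uniqP _) ?take_uniq // size_takel // ss.
- rewrite cardE => Dm; apply/fintype.subsetP => x xD; rewrite inE take_cat.
  by rewrite ltnNge Dm /= mem_cat mem_enum xD.
- rewrite cardE => mD; apply/fintype.subsetP => x; rewrite inE takel_cat //.
  by move=> /mem_take; rewrite mem_enum.
Qed.

(** Translation by the permutation relating the two datasets is a bijection of the symmetric
    group. *)
Lemma release_perm_eq (R : realType) (T : finType) (n : nat) (P : protocol T n)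
    (f : n.-tuple (alphabet P) -> R) (z1 z2 : n.-tuple (alphabet P)) :
  shuffled P -> perm_eq z1 z2 -> release f z1 = release f z2.
Proof.
move=> shP /tuple_permP[s z1E]; rewrite /release shP; congr (_ * _).
rewrite [RHS](reindex (fun r : 'S_n => (r * s)%g)) /=; last first.
  by exists (fun r : 'S_n => (r * s^-1)%g) => r _; rewrite ?mulgK ?mulgKV.
apply: eq_bigr => r _; congr f; apply: eq_from_tnth => i; rewrite !tnth_mktuple.
by rewrite permM (tnth_nth (tnth z1 i)) z1E -tnth_nth tnth_mktuple.
Qed.

(** Additions only raise a count, erasures only lower it, and replacements do either. The total
    uncertainty [lo + hi] is the same [budget] as the one that adversaries can hide in
    [corruptions_meet], so upper and lower bounds match. *)
Lemma corruption_count (A : adaptive_model) (T : finType) (n m : nat) (a : pred T) :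
  let P := model_protocol A T n m in
  exists (c : n.-tuple (alphabet P) -> nat) (lo hi : nat),
  [/\ (lo + hi = budget A m)%N,
      forall z (s : 'S_n), c [tuple tnth z (s i) | i < n] = c z &
      forall x z, z \in corruptions x ->
        (c z <= count a x + hi)%N /\ (count a x <= c z + lo)%N].
Proof.
have count_perm (U : finType) (b : pred U) (z : n.-tuple U) (s : 'S_n) :
    count b [tuple tnth z (s i) | i < n] = count b z.
  apply/seq.permP: b; rewrite perm_sym perm_sym; apply/tuple_permP; by exists s.
case: A => /=.
- exists (fun z => count a z), 0%N, m; split=> // x z.
  rewrite inE => /existsP[y /eqP ->]; rewrite count_cat addn0 leq_add2l leq_addr.
  by split=> //; rewrite -[leqRHS](size_tuple y) count_size.
- exists (fun z => count (fun o => if o is Some t then a t else false) z), m, 0%N.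
  split=> //; first by rewrite addn0.
  move=> x z; rewrite inE => /existsP[S /andP[/eqP <- /eqP ->]].
  rewrite !count_tnth addn0; split.
    by apply: leq_sum => i _; rewrite tnth_mktuple; case: ifP.
  by apply: sum_agree_off => i iS; rewrite tnth_mktuple (negbTE iS).
- exists (fun z => count a z), m, m; split=> //; first by rewrite addnn.
  move=> x z; rewrite inE => /existsP[S /andP[/eqP <- /forallP zx]].
  rewrite !count_tnth; split; apply: sum_agree_off => i iS;
    by have /implyP/(_ iS)/eqP -> := zx i.
Qed.

Lemma corruptions_meet (R : realType) (A : adaptive_model) (T : finType) (t0 : T)
    (n m : nat) (mn : (m <= n)%N)
    (u : (clean_size (model_protocol A T n m)).-tuple (T * T)) :
  exists z1 z2, [/\ z1 \in corruptions (map_tuple fst u),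
    z2 \in corruptions (map_tuple snd u) &
    (count (fun w => w.1 != w.2) u <= budget A m)%N ->
    forall g : n.-tuple (alphabet (model_protocol A T n m)) -> R,
      release g z1 = release g z2].
Proof.
have mI : (m <= #|'I_n|)%N by rewrite card_ord.
case: A u => /= u.
(* Each adversary appends the letters that the other dataset has at the disagreements, padded with
   [t0]; the two results are permutations of each other. *)
- pose D := [seq w <- u | w.1 != w.2].
  have fitP (s : seq T) : size (take m (s ++ nseq m t0)) == m.
    by rewrite size_takel // size_cat size_nseq leq_addl.
  pose y1 : m.-tuple T := Tuple (fitP (map snd D)).
  pose y2 : m.-tuple T := Tuple (fitP (map fst D)).
  have catP (x : (n - m).-tuple T) (y : m.-tuple T) : size (x ++ y) == n.
    by rewrite size_cat !size_tuple subnK.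
  exists (Tuple (catP (map_tuple fst u) y1)), (Tuple (catP (map_tuple snd u) y2)).
  split.
  + by rewrite inE; apply/existsP; exists y1.
  + by rewrite inE; apply/existsP; exists y2.
  + rewrite -size_filter -/D => Dm g; apply: release_perm_eq => //=.
    rewrite !take_cat !size_map ltnNge Dm /= !catA perm_cat2r.
    apply/seq.permP => b; rewrite !count_cat /D {Dm D y1 y2}.
    elim: (tval u) => //= w s IH.
    by case: eqP => /= [->|_]; lia.
(* Both adversaries erase the same set of positions, which covers all disagreements. *)
- pose D := [set i | (tnth u i).1 != (tnth u i).2]%SET.
  have [S [Sm DS _]] := set_of_card_comparable D mI.
  exists [tuple if i \in S then None else Some (tnth (map_tuple fst u) i) | i < n].
  exists [tuple if i \in S then None else Some (tnth (map_tuple snd u) i) | i < n].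
  split; try by rewrite inE; apply/existsP; exists S; rewrite Sm !eqxx.
  have -> : count (fun w => w.1 != w.2) u = #|D|.
    rewrite count_tnth -sum1_card [RHS]big_mkcond; apply: eq_bigr => i _.
    by rewrite inE; case: ifP.
  move=> /DS /fintype.subsetP sub g; congr release; apply: eq_from_tnth => i.
  rewrite !tnth_mktuple; case: ifPn => // /(contra (sub i)).
  by rewrite inE negbK !tnth_map => /eqP ->.
(* The datasets meet halfway at [z]: the first adversary moves to the second dataset on [S], and the
   second adversary moves to the first one on the remaining disagreements. *)
- pose D := [set i | (tnth u i).1 != (tnth u i).2]%SET.
  have cD : count (fun w => w.1 != w.2) u = #|D|.
    rewrite count_tnth -sum1_card [RHS]big_mkcond; apply: eq_bigr => i _.
    by rewrite inE; case: ifP.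
  have [S [Sm DS SD]] := set_of_card_comparable D mI.
  have [S' [Sm' DS' _]] := set_of_card_comparable (D :\: S) mI.
  pose z := [tuple if i \in S then (tnth u i).2 else (tnth u i).1 | i < n].
  have z1 : z \in corruptions (p := TV_protocol T n m) (map_tuple fst u).
    rewrite inE; apply/existsP; exists S; rewrite Sm eqxx; apply/forallP => i.
    by apply/implyP => /negbTE iS; rewrite tnth_mktuple iS tnth_map.
  have [Dm|Dm] := leqP #|D| m.*2.
    exists z, z; split=> //; rewrite inE; apply/existsP; exists S'.
    rewrite Sm' eqxx; apply/forallP => i; apply/implyP => iS'.
    rewrite tnth_mktuple tnth_map; case: ifPn => // iS.
    have DSm : (#|D :\: S| <= m)%N.
      have [/DS|/ltnW/SD] := leqP #|D| m.
        by rewrite -finset.setD_eq0 => /eqP ->; rewrite cards0.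
      by move=> /finset.setIidPr SDE; rewrite cardsD SDE Sm; lia.
    apply: contraR iS' => ne; apply: (fintype.subsetP (DS' DSm)).
    by rewrite !inE iS.
  (* Too many disagreements: the two outputs need only be legal. *)
  exists z, (map_tuple snd u); split=> //; last by rewrite cD leqNgt Dm.
  rewrite inE; apply/existsP; exists S; rewrite Sm eqxx; apply/forallP => i.
  by apply/implyP.
Qed.

Lemma corruptions_nonempty (A : adaptive_model) (T : finType) (t0 : T)
    (n m : nat) (mn : (m <= n)%N) (x : (clean_size (model_protocol A T n m)).-tuple T) :
  exists z, z \in corruptions x.
Proof.
have mI : (m <= #|'I_n|)%N by rewrite card_ord.
have [S [Sm _ _]] := set_of_card_comparable finset.set0 mI.
case: A x => /= x.
- have catP : size (x ++ nseq m t0) == n by rewrite size_cat size_tuple size_nseq subnK.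
  exists (Tuple catP); rewrite inE; apply/existsP.
  by exists [tuple of nseq m t0].
- exists [tuple if i \in S then None else Some (tnth x i) | i < n].
  by rewrite inE; apply/existsP; exists S; rewrite Sm !eqxx.
- exists x; rewrite inE; apply/existsP; exists S; rewrite Sm eqxx.
  by apply/forallP => i; apply/implyP.
Qed.

(** Once the budget is deducted, the expected counts of [a] remain [gap] apart, so a wrong answer
    needs a deviation of [gap / 2]. Chebyshev's bound at this deviation has a factor 4, whence 40
    for a total error of 1/10. *)
Lemma letter_count_testable (R : realType) (A : adaptive_model) (T : finType)
    (n m : nat) (p q : T -> R) (a : T) (gap : R) :
  is_pmf p -> is_pmf q -> p a <= q a -> (m <= n)%N -> 0 < gap ->
  gap + (budget A m)%:R <= (n - m)%:R * (q a - p a) ->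
  40 * n%:R * (p a + q a) <= gap ^+ 2 ->
  testable (model_protocol A T n m) p q.
Proof.
move=> pP qP pq mn gap0 gapE var.
have [c [lo [hi [lohi c_perm cP]]]] := corruption_count A n m (pred1 a).
set P := model_protocol A T n m in c c_perm cP *.
have /andP[Nlo Nhi] := clean_size_bounds A T n m.
set N := clean_size P in Nlo Nhi cP *.
have budgetE : (lo%:R + hi%:R)%R = (budget A m)%:R :> R by rewrite -natrD lohi.
have gapN : gap + lo%:R + hi%:R <= N%:R * (q a - p a).
  rewrite -addrA budgetE; apply: le_trans gapE _.
  by rewrite ler_wpM2r ?subr_ge0 // ler_nat.
pose dev (r : T -> R) (x : N.-tuple T) :=
  gap / 2 <= `|(count (pred1 a) x)%:R - N%:R * \sum_(t | pred1 a t) r t|.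
(* The midpoint between the highest reading expected under [p] and the lowest expected under [q]. *)
pose theta := (N%:R * p a + hi%:R + N%:R * q a - lo%:R) / 2.
apply: (@deterministic_test_testable R T n P p q (fun z => theta < (c z)%:R)
  (dev p) (dev q)) => //.
- by move=> z s; rewrite c_perm.
- move=> x z /cP[cz _] th; rewrite /dev big_pred1_eq.
  apply: le_trans (ler_norm _).
  have : (c z)%:R <= (count (pred1 a) x)%:R + hi%:R :> R by rewrite -natrD ler_nat.
  by move: th; rewrite /theta; lra.
- move=> x z /cP[_ cz]; rewrite -leNgt => th; rewrite /dev big_pred1_eq -normrN.
  apply: le_trans (ler_norm _).
  have : (count (pred1 a) x)%:R <= (c z)%:R + lo%:R :> R by rewrite -natrD ler_nat.
  by move: th; rewrite /theta; lra.
have cheb (r : T -> R) : is_pmf r ->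
    \sum_(x | dev r x) iid r x <= n%:R * r a / (gap / 2) ^+ 2.
  move=> rP; have gap2 : 0 < gap / 2 by rewrite divr_gt0.
  apply: le_trans (iid_chebyshev (pred1 a) N rP gap2) _.
  have r0 : 0 <= r a by case: rP.
  rewrite big_pred1_eq ler_wpM2r ?invr_ge0 ?sqr_ge0 //.
  by rewrite ler_wpM2r // ler_nat.
apply: le_trans (lerD (cheb p pP) (cheb q qP)) _.
rewrite -mulrDl -mulrDr ler_pdivrMr ?exprn_gt0 ?divr_gt0 //.
by rewrite expr_div_n; lra.
Qed.

(** * The two-scale instance *)

(** The coupling fails only when the number of disagreements exceeds the budget, hence its own mean
    by at least [s]; Chebyshev's inequality bounds this. *)
Lemma disagreement_error_sum (R : realType) (A : adaptive_model) (T : finType)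
    (t0 : T) (n m : nat) (mu : T * T -> R) (p q : T -> R) (s : R)
    (phi : n.-tuple (alphabet (model_protocol A T n m)) -> R) :
  (m <= n)%N -> is_pmf mu -> is_pmf p -> is_pmf q ->
  (forall t, p t = \sum_(u | u.1 == t) mu u) ->
  (forall t, q t = \sum_(u | u.2 == t) mu u) ->
  0 < s -> n%:R * (\sum_(u | u.1 != u.2) mu u) + s <= (budget A m)%:R ->
  is_test phi ->
  1 - n%:R * (\sum_(u | u.1 != u.2) mu u) / s ^+ 2 <=
    type_I_error p phi + type_II_error q phi.
Proof.
move=> mn muP pP qP pE qE s0 sle phiP.
set delta := \sum_(u | _) _ in sle *.
set P := model_protocol A T n m in phi phiP *.
have /andP[_ Nn] := clean_size_bounds A T n m; rewrite -/P in Nn.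
have d0 : 0 <= delta by apply: sumr_ge0 => u _; case: muP.
have Nd : (clean_size P)%:R * delta <= n%:R * delta by rewrite ler_wpM2r // ler_nat.
apply: le_trans (@coupling_error_sum R T n P mu p q
  (fun u => (count (fun w => w.1 != w.2) u <= budget A m)%N) phi muP pP qP pE qE
  (corruptions_nonempty t0 mn) (corruptions_meet R t0 mn) phiP).
rewrite lerD2l lerN2.
apply: (@le_trans _ _ ((clean_size P)%:R * delta / s ^+ 2)); last first.
  by rewrite ler_wpM2r ?invr_ge0 ?sqr_ge0.
apply: le_trans (iid_chebyshev (fun w => w.1 != w.2) (clean_size P) muP s0).
rewrite big_mkcond [leRHS]big_mkcond; apply: ler_sum => u _.
case: ifPn => [bad|_]; last by case: ifP => // _; exact: iid_ge0.
rewrite ifT //; apply: le_trans (ler_norm _); rewrite -/delta.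
have : (budget A m)%:R <= (count (fun w => w.1 != w.2) u)%:R :> R.
  by rewrite ler_nat ltnW // ltnNge.
lra.
Qed.

(* None is the rare letter (t is small) of the first scale, Some true the
   frequent letter of the second one. *)
Definition base_pmf (R : realType) (t : R) (o : option bool) : R :=
  if o is Some _ then (1 - t) / 2 else t.

Definition tilted_pmf (R : realType) (t d D : R) (o : option bool) : R :=
  match o with
  | None => t + d
  | Some true => (1 - t) / 2 + D
  | Some false => (1 - t) / 2 - d - D
  end.

(** A maximal coupling of [base_pmf t] and [base_pmf (t + d)]: the only disagreements turn a
    frequent letter into the rare one, so their probability is the total variation distance [d]. *)
Definition base_coupling (R : realType) (t d : R) (u : option bool * option bool) : R :=
  match u with
  | (None, None) => t
  | (Some _, None) => d / 2
  | (None, Some _) => 0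
  | (Some b, Some b') => if b == b' then (1 - t - d) / 2 else 0
  end.

Lemma sum_option_bool (R : realType) (F : option bool -> R) :
  \sum_o F o = F None + F (Some true) + F (Some false).
Proof.
rewrite (bigD1 None) // (bigD1 (Some true)) // (bigD1 (Some false)) //=.
by rewrite big1 ?addr0 ?addrA // => -[[]|].
Qed.

Lemma sum_pairs (R : realType) (S T : finType) (F : S * T -> R) :
  \sum_u F u = \sum_i \sum_j F (i, j).
Proof. by rewrite pair_bigA; apply: eq_bigr => -[]. Qed.

Lemma base_pmfP (R : realType) (t : R) : 0 <= t <= 1 -> is_pmf (base_pmf t).
Proof.
move=> t01; split=> [[b|]|]; rewrite ?sum_option_bool /=; lra.
Qed.

Lemma tilted_pmfP (R : realType) (t d D : R) :
  0 <= t -> 0 <= d -> 0 <= D -> t + 2 * (d + D) <= 1 -> is_pmf (tilted_pmf t d D).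
Proof.
move=> t0 d0 D0 le1; split=> [[[]|]|]; rewrite ?sum_option_bool /=; lra.
Qed.

Lemma base_couplingP (R : realType) (t d : R) :
  0 <= t -> 0 <= d -> t + d <= 1 -> is_pmf (base_coupling t d).
Proof.
move=> t0 d0 le1; split=> [[[[]|] [[]|]]|] /=; try lra.
by rewrite sum_pairs !sum_option_bool /=; lra.
Qed.

Lemma base_coupling_fst (R : realType) (t d : R) (o : option bool) :
  base_pmf t o = \sum_(u | u.1 == o) base_coupling t d u.
Proof.
rewrite big_mkcond /= sum_pairs.
by rewrite !sum_option_bool /=; case: o => [[]|] /=; lra.
Qed.

Lemma base_coupling_snd (R : realType) (t d : R) (o : option bool) :
  base_pmf (t + d) o = \sum_(u | u.2 == o) base_coupling t d u.
Proof.
rewrite big_mkcond /= sum_pairs.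
by rewrite !sum_option_bool /=; case: o => [[]|] /=; lra.
Qed.

Lemma base_coupling_neq (R : realType) (t d : R) :
  \sum_(u | u.1 != u.2) base_coupling t d u = d.
Proof.
rewrite big_mkcond /= sum_pairs.
by rewrite !sum_option_bool /=; lra.
Qed.

Lemma chi2_base (R : realType) (t d : R) : 0 < t <= 2^-1 ->
  \sum_o (base_pmf (t + d) o - base_pmf t o) ^+ 2 / base_pmf t o <= 2 * d ^+ 2 / t.
Proof.
move=> /andP[t0 t2]; rewrite sum_option_bool /=.
have -> : (t + d - t) ^+ 2 / t + ((1 - (t + d)) / 2 - (1 - t) / 2) ^+ 2 / ((1 - t) / 2)
    + ((1 - (t + d)) / 2 - (1 - t) / 2) ^+ 2 / ((1 - t) / 2)
    = d ^+ 2 / t + d ^+ 2 / (1 - t).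
  by field; rewrite !gt_eqF //; lra.
have : d ^+ 2 / (1 - t) <= d ^+ 2 / t.
  by rewrite ler_wpM2l ?sqr_ge0 // lef_pV2 ?posrE; lra.
by lra.
Qed.

(** The laws agree on the rare letter and differ by [D + d / 2], with opposite signs, on two letters
    of mass at least 1/4. *)
Lemma chi2_tilted (R : realType) (t d D : R) : 0 <= t -> 0 <= d -> t + d <= 2^-1 ->
  \sum_o (tilted_pmf t d D o - base_pmf (t + d) o) ^+ 2 / base_pmf (t + d) o <=
  8 * (D + d / 2) ^+ 2.
Proof.
move=> t0 d0 td; rewrite sum_option_bool /=.
have -> : (t + d - (t + d)) ^+ 2 / (t + d) +
   ((1 - t) / 2 + D - (1 - (t + d)) / 2) ^+ 2 / ((1 - (t + d)) / 2) +
   ((1 - t) / 2 - d - D - (1 - (t + d)) / 2) ^+ 2 / ((1 - (t + d)) / 2) =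
   4 * (D + d / 2) ^+ 2 / (1 - (t + d)).
  by rewrite subrr expr0n mul0r; field; rewrite !gt_eqF //; lra.
rewrite ler_pdivrMr; last lra.
have := sqr_ge0 (D + d / 2); nra.
Qed.

(** The law [base_pmf (t + d)] is an intermediate point. Passing to it from the tilted law costs
    1/10; against [base_pmf t] its error sum is at least 9/10, either because clean samples hardly
    differ or because the adversaries hide the difference. This leaves 8/10. *)
Lemma tilted_not_testable (R : realType) (A : adaptive_model) (n m : nat) (t d D : R) :
  (m <= n)%N -> 0 < t -> 0 <= d -> t + d <= 2^-1 -> is_pmf (tilted_pmf t d D) ->
  n%:R * (8 * (D + d / 2) ^+ 2) <= 101^-1 ->
  n%:R * (2 * d ^+ 2 / t) <= 101^-1 \/
  (exists s, [/\ 0 < s, n%:R * d + s <= (budget A m)%:R & n%:R * d / s ^+ 2 <= 10^-1]) ->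
  ~ testable (model_protocol A (option bool) n m) (base_pmf t) (tilted_pmf t d D).
Proof.
move=> mn t0 d0 td qP small near [phi [phiP]].
set P := model_protocol A _ n m in phi phiP *.
have /andP[_ Nn] := clean_size_bounds A (option bool) n m; rewrite -/P in Nn.
have pP : is_pmf (base_pmf t) by apply: base_pmfP; lra.
have bP : is_pmf (base_pmf (t + d)) by apply: base_pmfP; lra.
have scale (chi b : R) : 0 <= chi -> chi <= b -> n%:R * b <= 101^-1 ->
    (clean_size P)%:R * chi <= 101^-1.
  move=> chi0 chib; apply: le_trans; apply: ler_pM => //; by rewrite ler_nat.
have chi0 (p q : option bool -> R) : (forall o, 0 < p o) ->
    0 <= \sum_o (q o - p o) ^+ 2 / p o.
  by move=> p0; apply: sumr_ge0 => o _; rewrite divr_ge0 ?sqr_ge0 ?ltW.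
have p0 o : 0 < base_pmf t o by case: o => [b|] /=; lra.
have b0 o : 0 < base_pmf (t + d) o by case: o => [b|] /=; lra.
have tv_qb : \sum_(x : (clean_size P).-tuple _)
    `|iid (tilted_pmf t d D) x - iid (base_pmf (t + d)) x| <= 10^-1.
  apply: iid_chi2 => //; apply: scale small; first exact: chi0.
  by apply: chi2_tilted => //; lra.
have main : 9 / 10 <= type_I_error (base_pmf t) phi + type_II_error (base_pmf (t + d)) phi.
  case: near => [small_d|[s [s0 sle sd]]].
    have tv_pb : \sum_(x : (clean_size P).-tuple _)
        `|iid (base_pmf (t + d)) x - iid (base_pmf t) x| <= 10^-1.
      apply: iid_chi2 => //; apply: scale small_d; first exact: chi0.
      by apply: chi2_base; lra.
    have := clean_error_sum pP (corruptions_nonempty None mn) phiP.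
    have := type_I_error_lipschitz (base_pmf t) bP (is_testB phiP).
    under eq_bigr do rewrite distrC.
    by rewrite -!type_II_errorE; lra.
  have := @disagreement_error_sum R A _ None n m (base_coupling t d) (base_pmf t)
    (base_pmf (t + d)) s phi mn (base_couplingP _ _ _) pP bP
    (base_coupling_fst t d) (base_coupling_snd t d) s0.
  rewrite base_coupling_neq => /(_ _ _ _ sle phiP).
  by lra.
have := type_I_error_lipschitz (base_pmf (t + d)) qP (is_testB phiP).
under eq_bigr do rewrite distrC.
rewrite -!type_II_errorE => lip err.
lra.
Qed.

(** * Calibration of the instance: testability and non-testability at the two levels *)

Definition rate (R : realType) (A : adaptive_model) : R := (budget A 1)%:R.

Lemma budgetE (R : realType) (A : adaptive_model) (m : nat) :
  (budget A m)%:R = rate R A * m%:R.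
Proof. by case: A; rewrite /rate /= ?mul1r // -natrM mul2n. Qed.

Lemma rate_itv (R : realType) (A : adaptive_model) : 1 <= rate R A <= 2.
Proof. by case: A; rewrite /rate /= ?lexx ler1n ?ler_nat. Qed.

Lemma adaptive_protocolE (R : realType) (A : adaptive_model) (T : finType)
    (n : nat) (eps : R) :
  adaptive_protocol A T n eps = model_protocol A T n (Num.truncn (n%:R * eps)).
Proof. by case: A. Qed.

Lemma truncn_scale_le (R : realType) (n : nat) (eps : R) :
  0 <= eps <= 1 -> (Num.truncn (n%:R * eps) <= n)%N /\
  n%:R * eps - 1 <= (Num.truncn (n%:R * eps))%:R <= n%:R * eps.
Proof.
move=> /andP[e0 e1]; have ne0 : 0 <= n%:R * eps by rewrite mulr_ge0.
have /andP[le gt] := truncn_itv ne0; split; last first.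
  by rewrite le lerBlDr natr1 ltW.
by rewrite -(ler_nat R); apply: le_trans le _; rewrite ler_piMr.
Qed.

(* With eta = t^2 and lambda = 1 + 2h, the mass of the rare letter moves by 1 + h
   times what the corruptions of level eta can hide. *)
Definition rare_shift (R : realType) (A : adaptive_model) (h t : R) : R :=
  rate R A * (1 + h) * t ^+ 2.

(** This is [16 * lambda * eta], whereas corruptions of level [lambda * eta] hide a shift of about
    [2 * lambda * eta] at most. *)
Definition tilt (R : realType) (h t : R) : R := 16 * (1 + 2 * h) * t ^+ 2.

Lemma rare_shift_tilt_small (R : realType) (A : adaptive_model) (h t : R) :
  0 < h -> 0 < t -> (1 + h) * t <= 100^-1 ->
  [/\ t <= 100^-1, 0 < rare_shift A h t, rare_shift A h t <= t / 50, 0 < tilt h t &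
      tilt h t <= 32 / 100 * t].
Proof.
move=> h0 t0 small; have /andP[k1 k2] := rate_itv R A; rewrite /rare_shift /tilt.
have t1 : t <= 100^-1 by nra.
have w0 : 0 < (1 + h) * t ^+ 2 by rewrite mulr_gt0 ?exprn_gt0 //; lra.
have w1 : (1 + h) * t ^+ 2 <= t / 100 by nra.
have v0 : 0 < t ^+ 2 by rewrite exprn_gt0.
split=> //; nra.
Qed.

Lemma instance_pmf (R : realType) (A : adaptive_model) (h t : R) :
  0 < h -> 0 < t -> (1 + h) * t <= 100^-1 ->
  is_pmf (base_pmf t) /\ is_pmf (tilted_pmf t (rare_shift A h t) (tilt h t)).
Proof.
move=> h0 t0 small; have [t1 d0 d1 D0 D1] := rare_shift_tilt_small A h0 t0 small.
split; first by apply: base_pmfP; lra.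
by apply: tilted_pmfP; lra.
Qed.

Lemma rare_letter_testable (R : realType) (A : adaptive_model) (h t : R) (n : nat) :
  0 < h -> 0 < t -> (1 + h) * t <= 100^-1 -> t <= h ->
  480 <= n%:R * (h ^+ 2 * t ^+ 3) ->
  testable (adaptive_protocol A (option bool) n (t ^+ 2))
    (base_pmf t) (tilted_pmf t (rare_shift A h t) (tilt h t)).
Proof.
move=> h0 t0 small th nbig.
have [t1 d0 d1 D0 D1] := rare_shift_tilt_small A h0 t0 small.
have [pP qP] := instance_pmf A h0 t0 small.
have /andP[k1 k2] := rate_itv R A.
rewrite adaptive_protocolE.
have [|mn /andP[_ mle]] := @truncn_scale_le R n (t ^+ 2).
  by apply/andP; split; [exact: sqr_ge0 | nra].
set m := Num.truncn _ in mn mle *.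
have n0 : 0 < n%:R :> R.
  rewrite ltNge; apply/negP => nle; have : 0 < h ^+ 2 * t ^+ 3 by rewrite mulr_gt0 ?exprn_gt0.
  by nra.
(* The shift exceeds the budget by at least about [n * t ^+ 2 * h]. Half of this is the gap; the
   other half absorbs the loss from having only [n - m] samples guaranteed clean. *)
apply: (@letter_count_testable R A _ n m _ _ None (n%:R * t ^+ 2 * h / 2)) => //=.
- lra.
- by rewrite !mulr_gt0 ?exprn_gt0 ?invr_gt0.
- rewrite budgetE natrB // addrAC subrr add0r /rare_shift.
  set k := rate R A in k1 k2 *; set v := t ^+ 2 in mle *.
  have v0 : 0 < v by rewrite exprn_gt0.
  have w1 : (1 + h) * v <= h / 100 by rewrite /v; nra.
  have -> : (n%:R - m%:R) * (k * (1 + h) * v) =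
    k * (n%:R * ((1 + h) * v)) - k * (m%:R * ((1 + h) * v)) by ring.
  have : m%:R * ((1 + h) * v) <= n%:R * v * (h / 100).
    by apply: ler_pM => //; rewrite mulr_ge0 //; lra.
  have : 0 <= n%:R * v * h by rewrite !mulr_ge0 ?ltW.
  have -> : n%:R * ((1 + h) * v) = n%:R * v + n%:R * v * h by ring.
  move: mle; set M : R := m%:R; set y := n%:R * v; set z := y * h.
  set w := M * _ => My z0 wz.
  have {}wz : w <= z / 100 by move: wz; rewrite /z; lra.
  nra.
(* The masses of the rare letter sum to at most [3 * t], which gives 120; the square of the halved
   gap then brings 4 * 120 = 480. *)
- apply: (@le_trans _ _ (n%:R * (120 * t))).
    by rewrite [40 * _]mulrC -mulrA ler_wpM2l ?(ltW n0) //; lra.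
  have -> : (n%:R * t ^+ 2 * h / 2) ^+ 2 = n%:R * (t * (n%:R * (h ^+ 2 * t ^+ 3)) / 4) by field.
  rewrite ler_wpM2l ?(ltW n0) //.
  have := ler_wpM2l (ltW t0) nbig; lra.
Qed.

(** Serves only to show that the sample complexity at the higher level is finite. *)
Lemma balanced_letter_testable (R : realType) (A : adaptive_model) (h t : R) (n : nat) :
  0 < h -> 0 < t -> (1 + h) * t <= 100^-1 ->
  80 <= n%:R * ((1 + 2 * h) * t ^+ 2) ^+ 2 ->
  testable (adaptive_protocol A (option bool) n ((1 + 2 * h) * t ^+ 2))
    (base_pmf t) (tilted_pmf t (rare_shift A h t) (tilt h t)).
Proof.
move=> h0 t0 small nbig.
have [t1 d0 d1 D0 D1] := rare_shift_tilt_small A h0 t0 small.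
have [pP qP] := instance_pmf A h0 t0 small.
have /andP[k1 k2] := rate_itv R A.
have e0 : 0 < (1 + 2 * h) * t ^+ 2 by rewrite mulr_gt0 ?exprn_gt0 //; lra.
have tiltE : tilt h t = 16 * ((1 + 2 * h) * t ^+ 2) by rewrite /tilt mulrA.
rewrite adaptive_protocolE; move: nbig e0 tiltE; set e := (1 + 2 * h) * _ => nbig e0 tiltE.
have e1 : e <= 2^-1 by rewrite tiltE in D1; lra.
have [|mn /andP[_ mle]] := @truncn_scale_le R n e; first by lra.
set m := Num.truncn _ in mn mle *.
have n0 : 0 < n%:R :> R by rewrite ltNge; apply/negP => nle; nra.
apply: (@letter_count_testable R A _ n m _ _ (Some true) (n%:R * e)) => //=.
- lra.
- by rewrite mulr_gt0.
- rewrite budgetE natrB // addrAC subrr add0r tiltE.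
  set k := rate R A in k1 k2 *.
  have M0 : 0 <= m%:R :> R by [].
  have me : m%:R * e <= n%:R * e / 2 by nra.
  have -> : (n%:R - m%:R) * (16 * e) = 16 * (n%:R * e) - 16 * (m%:R * e) by ring.
  by nra.
- apply: (@le_trans _ _ (n%:R * 80)).
    by rewrite [40 * _]mulrC -mulrA ler_wpM2l ?(ltW n0) //; lra.
  have -> : (n%:R * e) ^+ 2 = n%:R * (n%:R * e ^+ 2) by ring.
  by rewrite ler_wpM2l ?(ltW n0).
Qed.

(** Both shifts are of order [t ^+ 2], so all powers of [t] cancel. Here [y] stands for [n * t ^+ 4]
    in the first bound and for [n * t ^+ 3] in the second. *)
Lemma instance_chi2_small (R : realType) (A : adaptive_model) (h t y : R) :
  0 < h -> 0 < t -> y * (1 + h) ^+ 2 <= (10 ^+ 6)^-1 ->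
  (0 <= y -> y / t ^+ 4 * (8 * (tilt h t + rare_shift A h t / 2) ^+ 2) <= 101^-1) /\
  (0 <= y -> y / t ^+ 3 * (2 * rare_shift A h t ^+ 2 / t) <= 101^-1).
Proof.
move=> h0 t0 small; have /andP[k1 k2] := rate_itv R A; rewrite /rare_shift /tilt.
set k := rate R A in k1 k2 *.
have H2 : 0 <= (1 + h) ^+ 2 := sqr_ge0 _.
split=> y0; have yH : 0 <= y * (1 + h) ^+ 2 by rewrite mulr_ge0.
- have -> : y / t ^+ 4 * (8 * (16 * (1 + 2 * h) * t ^+ 2 + k * (1 + h) * t ^+ 2 / 2) ^+ 2)
    = 8 * (y * (16 * (1 + 2 * h) + k * (1 + h) / 2) ^+ 2).
    by field; rewrite gt_eqF.
  have : (16 * (1 + 2 * h) + k * (1 + h) / 2) ^+ 2 <= (33 * (1 + h)) ^+ 2.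
    by rewrite lerXn2r // ?nnegrE; nra.
  move=> /(ler_wpM2l y0); rewrite exprMn; lra.
- have -> : y / t ^+ 3 * (2 * (k * (1 + h) * t ^+ 2) ^+ 2 / t) = 2 * k ^+ 2 * (y * (1 + h) ^+ 2).
    by field; rewrite gt_eqF.
  nra.
Qed.

(** A crude bound, far below the true order, used only to make the sample complexity at level [eta]
    diverge. *)
Lemma clean_not_testable (R : realType) (A : adaptive_model) (h t : R) (n : nat) :
  0 < h -> 0 < t -> (1 + h) * t <= 100^-1 ->
  n%:R * t * (1 + h) ^+ 2 <= (10 ^+ 6)^-1 ->
  ~ testable (adaptive_protocol A (option bool) n (t ^+ 2))
    (base_pmf t) (tilted_pmf t (rare_shift A h t) (tilt h t)).
Proof.
move=> h0 t0 small nsmall.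
have [t1 d0 d1 D0 D1] := rare_shift_tilt_small A h0 t0 small.
have [pP qP] := instance_pmf A h0 t0 small.
have n0 : 0 <= n%:R :> R by [].
rewrite adaptive_protocolE.
have [|mn _] := @truncn_scale_le R n (t ^+ 2).
  by apply/andP; split; [exact: sqr_ge0 | nra].
have pow j : n%:R * t ^+ j.+1 * (1 + h) ^+ 2 <= (10 ^+ 6)^-1.
  apply: le_trans nsmall; rewrite ler_wpM2r ?sqr_ge0 // ler_wpM2l //.
  by rewrite exprS ler_piMr ?(ltW t0) // exprn_ile1 //; lra.
have [c4 _] := instance_chi2_small A h0 t0 (pow 3).
have [_ c3] := instance_chi2_small A h0 t0 (pow 2).
apply: tilted_not_testable => //; try lra.
- by rewrite -[n%:R](@mulfK _ (t ^+ 4)) ?expf_neq0 ?gt_eqF // c4 ?mulr_ge0 ?exprn_ge0 ?(ltW t0).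
- left; by rewrite -[n%:R](@mulfK _ (t ^+ 3)) ?expf_neq0 ?gt_eqF // c3 ?mulr_ge0 ?exprn_ge0 ?(ltW t0).
Qed.

Lemma contaminated_not_testable (R : realType) (A : adaptive_model) (h t : R) (n : nat) :
  0 < h -> 0 < t -> (1 + h) * t <= 100^-1 ->
  10 ^+ 8 * (1 + h) ^+ 3 * t <= h ^+ 2 ->
  n%:R * t ^+ 4 * (1 + h) ^+ 2 <= (10 ^+ 6)^-1 ->
  ~ testable (adaptive_protocol A (option bool) n ((1 + 2 * h) * t ^+ 2))
    (base_pmf t) (tilted_pmf t (rare_shift A h t) (tilt h t)).
Proof.
move=> h0 t0 small tsmall nsmall.
have [t1 d0 d1 D0 D1] := rare_shift_tilt_small A h0 t0 small.
have [pP qP] := instance_pmf A h0 t0 small.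
have /andP[k1 k2] := rate_itv R A.
have n0 : 0 <= n%:R :> R by [].
have tiltE : tilt h t = 16 * ((1 + 2 * h) * t ^+ 2) by rewrite /tilt mulrA.
have v0 : 0 < t ^+ 2 by rewrite exprn_gt0.
rewrite adaptive_protocolE.
have [|mn /andP[mge _]] := @truncn_scale_le R n ((1 + 2 * h) * t ^+ 2).
  by rewrite tiltE in D0 D1; lra.
set m := Num.truncn _ in mn mge *.
have [c4 _] := instance_chi2_small A h0 t0 nsmall.
apply: tilted_not_testable => //; try lra.
  by rewrite -[n%:R](@mulfK _ (t ^+ 4)) ?expf_neq0 ?gt_eqF // c4 ?mulr_ge0 ?exprn_ge0 ?(ltW t0).
(* Below order [t ^- 3] clean samples carry too little information about the rare letter. Above it,
   the budget is large enough to dominate the fluctuations of the number of disagreements. *)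
have [few|many] := leP (n%:R * t ^+ 3 * (1 + h) ^+ 2) (10 ^+ 6)^-1.
  have [_ c3] := instance_chi2_small A h0 t0 few.
  by left; rewrite -[n%:R](@mulfK _ (t ^+ 3)) ?expf_neq0 ?gt_eqF // c3 ?mulr_ge0 ?exprn_ge0 ?(ltW t0).
(* The budget exceeds the mean number of disagreements by [rate R A * n * t ^+ 2 * h], up to the
   rounding loss [rate R A]; half of [n * t ^+ 2 * h] leaves room for that loss. *)
right; exists (n%:R * t ^+ 2 * h / 2).
(* Multiply [tsmall] by [n * t ^+ 2] and insert [many]: 100 is 10^8 / 10^6. *)
have vbig : 100 * (1 + h) <= n%:R * t ^+ 2 * h ^+ 2.
  have H3 : 0 < (1 + h) ^+ 2 by rewrite exprn_gt0 //; lra.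
  have nv : 0 <= n%:R * t ^+ 2 by rewrite mulr_ge0 // ltW.
  have := ler_wpM2l nv tsmall.
  have -> : n%:R * t ^+ 2 * (10 ^+ 8 * (1 + h) ^+ 3 * t) =
    10 ^+ 8 * (1 + h) * (n%:R * t ^+ 3 * (1 + h) ^+ 2) by ring.
  apply: le_trans; have := ltW many; set z := n%:R * _ * _ => zbig; nra.
have n1 : 0 < n%:R :> R.
  rewrite lt_neqAle n0 andbT; apply/eqP => nE; move: vbig; rewrite -nE !mul0r; lra.
have vbig1 : 100 <= n%:R * t ^+ 2 * h.
  have : 0 <= n%:R * t ^+ 2 * h by rewrite !mulr_ge0 // ltW.
  move: vbig; rewrite [h ^+ 2]expr2 mulrA; set z := n%:R * t ^+ 2 * h => vbig z0; nra.
split.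
- by rewrite !mulr_gt0 ?invr_gt0.
- rewrite budgetE /rare_shift; set k := rate R A in k1 k2 *.
  have : k * (n%:R * ((1 + 2 * h) * t ^+ 2) - 1) <= k * m%:R by rewrite ler_wpM2l //; lra.
  apply: le_trans.
  have -> : n%:R * (k * (1 + h) * t ^+ 2) = k * (n%:R * t ^+ 2) + k * (n%:R * t ^+ 2 * h) by ring.
  have -> : k * (n%:R * ((1 + 2 * h) * t ^+ 2) - 1) =
    k * (n%:R * t ^+ 2) + 2 * (k * (n%:R * t ^+ 2 * h)) - k by ring.
  move: vbig1; set z := n%:R * t ^+ 2 * h => vbig1; nra.
- rewrite /rare_shift; set k := rate R A in k1 k2 *.
  rewrite ler_pdivrMr ?exprn_gt0 ?mulr_gt0 ?invr_gt0 //.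
  have -> : n%:R * (k * (1 + h) * t ^+ 2) = (n%:R * t ^+ 2) * (k * (1 + h)) by ring.
  have -> : 10^-1 * (n%:R * t ^+ 2 * h / 2) ^+ 2 =
    (n%:R * t ^+ 2) * (n%:R * t ^+ 2 * h ^+ 2 / 40) by field.
  rewrite ler_wpM2l ?mulr_ge0 ?(ltW v0) //; nra.
Qed.

(** * Bounds on the sample complexity and the polynomial jump *)

Lemma sample_complexity_le (R : realType) (A : adaptive_model) (T : finType)
    (p q : T -> R) (eps : R) (n : nat) :
  testable (adaptive_protocol A T n eps) p q ->
  (sample_complexity A p q eps <= n%:R%:E)%E.
Proof. by move=> nP; apply: ereal_inf_lbound; exists n. Qed.

Lemma sample_complexity_ge (R : realType) (A : adaptive_model) (T : finType)
    (p q : T -> R) (eps b : R) :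
  (forall n : nat, n%:R <= b -> ~ testable (adaptive_protocol A T n eps) p q) ->
  (b%:E <= sample_complexity A p q eps)%E.
Proof.
move=> small; apply: le_ereal_inf_tmp => _ [n nP <-]; rewrite lee_fin.
by have [//|/ltW/small] := leP b n%:R.
Qed.

Lemma instance_sample_complexity (R : realType) (A : adaptive_model) (h t : R) :
  0 < h -> 0 < t -> (1 + h) * t <= 100^-1 -> t <= h ->
  10 ^+ 8 * (1 + h) ^+ 3 * t <= h ^+ 2 ->
  let p := base_pmf t in let q := tilted_pmf t (rare_shift A h t) (tilt h t) in
  let c0 := (10 ^+ 6 * (1 + h) ^+ 2)^-1 in
  [/\ ((c0 / t)%:E <= sample_complexity A p q (t ^+ 2))%E,
      (sample_complexity A p q (t ^+ 2) <= ((480 / h ^+ 2 + 1) / t ^+ 3)%:E)%E,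
      (sample_complexity A p q ((1 + 2 * h) * t ^+ 2) < +oo)%E &
      ((c0 / t ^+ 4)%:E <= sample_complexity A p q ((1 + 2 * h) * t ^+ 2))%E].
Proof.
move=> h0 t0 small th tsmall p q c0.
have H2 : 0 < (1 + h) ^+ 2 by rewrite exprn_gt0 //; lra.
have c0E : c0 * (1 + h) ^+ 2 = (10 ^+ 6)^-1 by rewrite /c0; field; rewrite gt_eqF //; lra.
split.
- apply: sample_complexity_ge => n; rewrite ler_pdivlMr // => nc.
  by apply: clean_not_testable => //; rewrite -c0E ler_wpM2r ?(ltW H2).
- have x0 : 0 < h ^+ 2 * t ^+ 3 by rewrite mulr_gt0 ?exprn_gt0.
  pose x := 480 / (h ^+ 2 * t ^+ 3).
  have xge0 : 0 <= x by rewrite divr_ge0 ?ler0n ?(ltW x0).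
  have /andP[le gt] := truncn_itv xge0.
  have big : 480 <= (Num.truncn x).+1%:R * (h ^+ 2 * t ^+ 3).
    by move: gt; rewrite {1}/x ltr_pdivrMr // => /ltW.
  have nP := rare_letter_testable A h0 t0 small th big.
  apply: (le_trans (sample_complexity_le nP)).
  (* The [+ 1] in the constant pays for rounding up, since [1 <= 1 / t ^+ 3]. *)
  rewrite lee_fin -natr1 mulrDl; apply: lerD.
    by apply: le_trans le _; rewrite /x invfM mulrA.
  have t1 : t <= 1 by nra.
  by rewrite mul1r invf_ge1 ?exprn_gt0 // exprn_ile1 ?(ltW t0).
- pose x := 80 / ((1 + 2 * h) * t ^+ 2) ^+ 2.
  have big : 80 <= (Num.truncn x).+1%:R * ((1 + 2 * h) * t ^+ 2) ^+ 2.
    rewrite -ler_pdivrMr; first exact: ltW (truncnS_gt x).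
    by rewrite exprn_gt0 // mulr_gt0 ?exprn_gt0 //; lra.
  have nP := balanced_letter_testable A h0 t0 small big.
  exact: le_lt_trans (sample_complexity_le nP) (ltry _).
- apply: sample_complexity_ge => n; rewrite ler_pdivlMr ?exprn_gt0 // => nc.
  by apply: contaminated_not_testable => //; rewrite -c0E ler_wpM2r ?(ltW H2).
Qed.

Unset Implicit Arguments.

Theorem corollary7p8 (R : realType) (A : adaptive_model) (lambda : R) :
  1 < lambda ->
  exists (a c : R) (X : nat -> finType) (p q : forall k, X k -> R)
         (eta : nat -> R),
    [/\ 1 < a /\ 0 < c,
        forall k, [/\ is_pmf (p k), is_pmf (q k), 0 < eta k &
                      lambda * eta k < 1],
        sample_complexity A (p k) (q k) (eta k) @[k --> \oo] --> +oo%E,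
        forall k, (sample_complexity A (p k) (q k) (lambda * eta k)%R < +oo)%E
      & forall k, (c%:E * (sample_complexity A (p k) (q k) (eta k)) `^ a
                   <= sample_complexity A (p k) (q k) (lambda * eta k)%R)%E].
Proof.
move=> lambda1; have [h [h0 ->]] : exists h, 0 < h /\ lambda = 1 + 2 * h.
  by exists ((lambda - 1) / 2); split; [lra | field].
have H1 : 0 < 1 + h by lra.
(* The three entries of the minimum are the three smallness conditions of
   [instance_sample_complexity]. *)
pose tmax := Num.min (100^-1 / (1 + h)) (Num.min h (h ^+ 2 / (10 ^+ 8 * (1 + h) ^+ 3))).
have tmax0 : 0 < tmax.
  by rewrite /tmax !lt_min h0 !divr_gt0 ?mulr_gt0 ?exprn_gt0.
pose t k : R := tmax / k.+1%:R.
have t0 k : 0 < t k by rewrite divr_gt0.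
have tle k : t k <= tmax by rewrite ler_pdivrMr // ler_peMr ?(ltW tmax0) // ler1n.
have small k : (1 + h) * t k <= 100^-1.
  by rewrite mulrC -ler_pdivlMr //; apply: le_trans (tle k) _; rewrite ge_min lexx.
have th k : t k <= h by apply: le_trans (tle k) _; rewrite !ge_min lexx orbT.
have tsmall k : 10 ^+ 8 * (1 + h) ^+ 3 * t k <= h ^+ 2.
  rewrite mulrC -ler_pdivlMr ?mulr_gt0 ?exprn_gt0 //.
  by apply: le_trans (tle k) _; rewrite !ge_min lexx !orbT.
have main k := instance_sample_complexity A h0 (t0 k) (small k) (th k) (tsmall k).
pose c0 : R := (10 ^+ 6 * (1 + h) ^+ 2)^-1; pose C : R := 480 / h ^+ 2 + 1.
have c0pos : 0 < c0 by rewrite invr_gt0 mulr_gt0 ?exprn_gt0.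
have Cpos : 0 < C by rewrite addr_gt0 ?ltr01 ?divr_gt0 ?ltr0n ?exprn_gt0.
(* Raising the upper bound [C / t ^+ 3] to the power 4/3 gives [t ^- 4], the order of the lower
   bound at the higher level; [c] cancels the constants. *)
exists (4 / 3), (c0 / C `^ (4 / 3)), (fun=> option bool), (fun k => base_pmf (t k)),
  (fun k => tilted_pmf (t k) (rare_shift A h (t k)) (tilt h (t k))), (fun k => t k ^+ 2).
split.
- by split; [lra | rewrite divr_gt0 ?powR_gt0].
- move=> k; have [pP qP] := instance_pmf A h0 (t0 k) (small k).
  have [t1 _ _ _ D1] := rare_shift_tilt_small A h0 (t0 k) (small k).
  split=> //; first by rewrite exprn_gt0.
  (* The tilt is 16 times the higher level, so its smallness bounds that level. *)
  by move: D1; rewrite /tilt; lra.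
(* The lower bound [c0 / t k] grows linearly in [k]. *)
- apply/cvgeyPge => M; near=> k.
  have [ge _ _ _] := main k; apply: le_trans ge; rewrite lee_fin -/c0.
  rewrite /t invf_div mulrA ler_pdivlMr // mulrC -ler_pdivrMl //.
  have : c0^-1 * (tmax * M) <= k%:R by near: k; exact: nbhs_infty_ger.
  by move=> /le_trans; apply; rewrite ler_nat.
- by move=> k; have [] := main k.
- move=> k; have [lo hi _ big] := main k; apply: le_trans big; rewrite -/c0.
  set sc := sample_complexity _ _ _ _ in lo hi *.
  have sc0 : (0 <= sc)%E.
    by apply: le_trans lo; rewrite lee_fin divr_ge0 ?(ltW c0pos) ?(ltW (t0 k)).
  have : (sc `^ (4 / 3) <= ((C / t k ^+ 3) `^ (4 / 3))%:E)%E.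
    rewrite -poweR_EFin; apply: gt0_ler_poweR => //.
      by rewrite in_itv /= sc0 leey.
    by rewrite in_itv /= leey andbT lee_fin divr_ge0 ?exprn_ge0 ?(ltW Cpos) ?(ltW (t0 k)).
  have cC : 0 <= c0 / C `^ (4 / 3) by rewrite divr_ge0 ?powR_ge0 ?(ltW c0pos).
  move=> le; have cC' : (0 <= (c0 / C `^ (4 / 3))%:E)%E by rewrite lee_fin.
  apply: (le_trans (lee_wpmul2l cC' le)).
  have tV : 0 <= (t k)^-1 by rewrite invr_ge0 ltW.
  have -> : (C / t k ^+ 3) `^ (4 / 3) = C `^ (4 / 3) / t k ^+ 4.
    rewrite powRM ?invr_ge0 ?exprn_ge0 ?(ltW Cpos) ?(ltW (t0 k)) // -!exprVn; congr (_ * _).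
    rewrite -powR_mulrn // -powRrM -powR_mulrn //; congr (_ `^ _); by field.
  by rewrite -EFinM lee_fin mulrA divfK // gt_eqF // powR_gt0.
Unshelve. all: end_near.
Qed.
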